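(* Let $R$ be an infinite principal ideal domain that is not a field. If the set of units $U(R)$ is not open in $M(R)$, then $R$ has infinitely many maximal ideals.
   Context: For $r\in R$ let $\sigma_r:=\{s\in R: \langle r\rangle+\langle s\rangle=R\}$, where $\langle r\rangle$ is the ideal generated by $r$. Write $R^0=R\setminus\{0\}$ and $\sigma_k^0=\sigma_k\setminus\{0\}$. The Macías space $M(R)$ is the set $R^0$ with the topology having basis $\{\sigma_k^0: k\in R^0\}$. $U(R)$ denotes the set of units of $R$. *)

(* Defs.v *)
From HB Require Import structures.
From mathcomp Require Import all_boot all_order all_algebra.
From mathcomp Require Import all_classical topology_structure.
Set Implicit Arguments.
Unset Strict Implicit.
Unset Printing Implicit Defensive.
Import GRing.Theory.
Local Open Scope classical_set_scope.
Local Open Scope ring_scope.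

Section Ideals.
Variable R : comNzRingType.

(* Unlike the library's [idealr], this is not restricted to boolean predicates
   and the unit ideal [setT] is allowed. *)
Definition is_ideal (I : set R) : Prop :=
  [/\ I 0,
      forall x y, I x -> I y -> I (x + y) &
      forall a x, I x -> I (a * x)].

Definition ideal_gen (G : set R) : set R := smallest is_ideal G.

Definition ideal_add (I J : set R) : set R := [set x + y | x in I & y in J].

Definition maximal_ideal (I : set R) : Prop :=
  [/\ is_ideal I, I <> setT &
      forall J, is_ideal J -> I `<=` J -> J = I \/ J = setT].

Definition sigma (r : R) : set R :=
  [set s | ideal_add (ideal_gen [set r]) (ideal_gen [set s]) = setT].

Lemma ideal_gen1E (r : R) : ideal_gen [set r] = [set a * r | a in setT].
Proof.
apply/seteqP; split => [|_ [a _ <-] J [[_ _ JM] rJ]]; last exact/JM/rJ.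
apply: smallest_sub => [|_ ->]; last by exists 1; rewrite ?mul1r.
split; first by exists 0; rewrite ?mul0r.
  by move=> _ _ [a _ <-] [b _ <-]; exists (a + b); rewrite ?mulrDl.
by move=> c _ [a _ <-]; exists (c * a); rewrite ?mulrA.
Qed.

Lemma sigmaP (r s : R) : sigma r s <-> exists a b, a * r + b * s = 1.
Proof.
rewrite /sigma /= !ideal_gen1E; split=> [rs|[a [b ab]]].
  have : [set: R] 1 by [].
  by rewrite -rs => -[_ [a _ <-]] [_ [b _ <-]] ab; exists a, b.
apply/seteqP; split=> // t _.
exists (t * a * r); first by exists (t * a).
exists (t * b * s); first by exists (t * b).
by rewrite -!mulrA -mulrDr ab mulr1.
Qed.

Lemma sigmaM (r s t : R) : sigma (r * s) t <-> sigma r t /\ sigma s t.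
Proof.
rewrite !sigmaP; split=> [[a [b ab]]|[[a [b ab]] [c [d cd]]]].
  split; first by exists (a * s), b; rewrite -ab mulrAC -mulrA.
  by exists (a * r), b; rewrite -ab mulrA.
exists (a * c), (a * r * d + b).
rewrite -[RHS]ab -[a * r in RHS]mulr1 -cd mulrDl mulrDr addrA.
by congr (_ + _ + _); rewrite -?mulrA //; congr (_ * _); rewrite mulrCA.
Qed.

End Ideals.

Definition is_pid (R : idomainType) : Prop :=
  forall I : set R, is_ideal I -> exists a : R, I = ideal_gen [set a].

Definition macias (R : idomainType) : Type := {r : R | r != 0}.

HB.instance Definition _ (R : idomainType) := Choice.on (macias R).

Section MaciasTopology.
Variable R : idomainType.

Definition sigma0 (k : R) : set (macias R) := [set s | sigma k (sval s)].

Definition macias_basis : set (set (macias R)) :=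
  [set sigma0 k | k in [set k : R | k != 0]].

Let macias_basis_cover : \bigcup_(B in macias_basis) B = setT.
Proof.
apply/seteqP; split=> // s _; exists (sigma0 1).
  by exists 1; rewrite //= oner_eq0.
by apply/sigmaP; exists 1, 0; rewrite mul1r mul0r addr0.
Qed.

Let macias_basis_join (A B : set (macias R)) (s : macias R) :
  macias_basis A -> macias_basis B -> A s -> B s ->
  exists C, [/\ macias_basis C, C s & C `<=` A `&` B].
Proof.
move=> [k k0 <-] [l l0 <-] ks ls; exists (sigma0 (k * l)); split.
- by exists (k * l) => //=; rewrite mulf_neq0.
- exact/sigmaM.
- by move=> t /sigmaM.
Qed.

HB.instance Definition _ := @isBaseTopological.Build (macias R)
  (set (macias R)) macias_basis id macias_basis_cover macias_basis_join.

Lemma macias_openE (A : set (macias R)) :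
  open A <->
  exists2 D, D `<=` macias_basis & \bigcup_(B in D) B = A.
Proof. by []. Qed.

Definition macias_units : set (macias R) :=
  [set u | sval u \is a GRing.unit].

End MaciasTopology.

(* Main.v *)
(** If there were only finitely many maximal ideals, some nonzero [k] would lie in
    all of them: each is nonzero because [R] is not a field, and in a domain
    finitely many nonzero ideals share a nonzero element, namely a product.  An
    element comaximal with [k] then lies in no maximal ideal, hence is a unit by
    Krull's theorem, so [U(R)] would be the basic open set [sigma0 k]. *)
Require Import Defs.
From HB Require Import structures.
From mathcomp Require Import all_boot all_order all_algebra.
From mathcomp Require Import all_classical topology_structure.
Import GRing.Theory.
Local Open Scope classical_set_scope.
Local Open Scope ring_scope.

Lemma is_ideal_gen (R : comNzRingType) (G : set R) : is_ideal (ideal_gen G).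
Proof.
split=> [J [[]] //|x y Gx Gy J [JI GJ]|a x Gx J [JI GJ]]; case: (JI) => _ JD JM.
  by apply: JD; [exact: Gx|exact: Gy].
by apply: JM; exact: Gx.
Qed.

Lemma mem_ideal_gen (R : comNzRingType) (G : set R) : G `<=` ideal_gen G.
Proof. by move=> x Gx J [_]; exact. Qed.

Lemma is_ideal_eqT (R : comNzRingType) (I : set R) :
  is_ideal I -> I 1 -> I = setT.
Proof.
by move=> [_ _ IM] I1; apply/seteqP; split=> // x _; rewrite -[x]mulr1; exact: IM.
Qed.

Lemma ideal_gen1_unit (R : comUnitRingType) (x : R) :
  ideal_gen [set x] 1 <-> x \is a GRing.unit.
Proof.
rewrite ideal_gen1E; split=> [[a _ ax]|xU]; last by exists x^-1; rewrite ?mulVr.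
by apply/unitrPr; exists a; rewrite mulrC.
Qed.

(** Two summands taken from different members of the chain both lie in the larger one. Nonemptiness
    is what supplies [0]. *)
Lemma bigcup_chain_is_ideal (R : comNzRingType) (F : set (set R)) :
  F !=set0 -> total_on F subset -> F `<=` @is_ideal R ->
  is_ideal (\bigcup_(I in F) I).
Proof.
move=> [I FI] Ftot Fideal; split.
- by exists I => //; case: (Fideal _ FI).
- move=> x y [A FA Ax] [B FB By]; have [AB|BA] := Ftot _ _ FA FB.
    by exists B => //; have [_ BD _] := Fideal _ FB; apply: BD => //; exact: AB.
  by exists A => //; have [_ AD _] := Fideal _ FA; apply: AD => //; exact: BA.
- move=> a x [A FA Ax]; exists A => //.
  by have [_ _ AM] := Fideal _ FA; exact: AM.
Qed.

(** Krull's theorem: Zorn's lemma applied to the ideals that contain [I] and omit [1]. Omitting [1]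
    is preserved by unions, unlike merely differing from [setT]. *)
Lemma exists_maximal_ideal (R : comNzRingType) (I : set R) :
  is_ideal I -> ~ I 1 -> exists2 M, maximal_ideal M & I `<=` M.
Proof.
move=> II I1; pose proper A := [/\ is_ideal A, I `<=` A & ~ A 1].
(* The disjunct [set0] accommodates the empty chain in [Zorn_bigcup]. *)
have [|A [PA Amax]] := @Zorn_bigcup R [set A | A = set0 \/ proper A].
  move=> F FP Ftot; have [FI|FI] := pselect (exists2 A, F A & proper A); last first.
    left; rewrite -subset0 => x [A FA Ax]; case: (FP _ FA) => [A0|pA].
      by rewrite A0 in Ax.
    by apply: FI; exists A.
  right; have [A FA pA] := FI.
  (* Dropping the empty members leaves the union unchanged and makes the chain a nonempty chain of
     proper ideals. *)
  have -> : \bigcup_(X in F) X = \bigcup_(X in F `&` proper) X.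
    apply/seteqP; split=> x [B FB Bx]; last by case: FB => FB _; exists B.
    by exists B => //; split=> //; case: (FP _ FB) => // B0; rewrite B0 in Bx.
  split.
  - apply: bigcup_chain_is_ideal; first by exists A.
      by move=> B C [FB _] [FC _]; exact: Ftot.
    by move=> B [_ []].
  - by move=> x Ix; exists A => //; have [_ IA _] := pA; exact: IA.
  - by move=> [B [_ [_ _ B1]]].
have pA : proper A.
  (* The maximal element is not [set0], since [I] is admissible and strictly larger. *)
  case: PA => // A0; exfalso; apply: (Amax I);
    last by right; exact: And3 II (@subset_refl _ I) I1.
  by rewrite A0; split=> // /(_ 0); apply; case: II.
have [AI IA A1] := pA; exists A => //; split=> //; first by move=> AT; apply: A1; rewrite AT.
move=> J JI AJ; have [J1|J1] := pselect (J 1); first by right; exact: is_ideal_eqT.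
left; apply/seteqP; split=> //; apply: contrapT => JA.
by apply: (Amax J) => //; right; split=> // x /IA /AJ.
Qed.

Lemma maximal_ideal_not1 (R : comNzRingType) (M : set R) :
  maximal_ideal M -> ~ M 1.
Proof. by case=> MI MT _ M1; apply: MT; exact: is_ideal_eqT. Qed.

(** If [M] were zero, it would lie in the ideal of any [x != 0]. By maximality that ideal is [M],
    impossible as it contains [x], or the whole ring, so that [x] is a unit and [R] a field. *)
Lemma maximal_ideal_neq0 (R : comUnitRingType) (M : set R) :
  ~ GRing.field_axiom R -> maximal_ideal M -> exists2 a, a != 0 & M a.
Proof.
move=> Rnf Mmax; apply: contrapT => M0; apply: Rnf => x x0.
have [[M00 _ _] _ MJ] := Mmax; apply/ideal_gen1_unit.
have xI := is_ideal_gen R [set x].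
have Mx : M `<=` ideal_gen [set x].
  move=> y My; have [->|y0] := eqVneq y 0; first by case: xI.
  by exfalso; apply: M0; exists y.
case: (MJ _ xI Mx) => [xM|-> //].
by exfalso; apply: M0; exists x => //; rewrite -xM; exact: mem_ideal_gen.
Qed.

Lemma finite_ideals_common_neq0 (R : idomainType) (F : set (set R)) :
  finite_set F ->
  (forall I, F I -> is_ideal I /\ exists2 a, a != 0 & I a) ->
  exists2 k, k != 0 & forall I, F I -> I k.
Proof.
move=> /finite_seqP[s ->]; elim: s => [_|J s IHs Fs].
  by exists 1; rewrite ?oner_eq0.
have [I Is|k k0 sk] := IHs; first by apply: Fs; rewrite /= inE; apply/orP; right.
have [|[_ _ JM] [a a0 Ja]] := Fs J; first by rewrite /= inE eqxx.
(* [k] serves the ideals in [s] and [a] serves [J]; absorption puts their product in all of them. *)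
exists (k * a); first by rewrite mulf_neq0.
move=> I /=; rewrite inE => /orP[/eqP ->|Is]; first exact: JM.
have [|[_ _ IM] _] := Fs I; first by rewrite /= inE Is orbT.
by rewrite mulrC; apply: IM; exact: sk.
Qed.

(** Here [k] is in the Jacobson radical: a maximal ideal above a non-unit [s] would contain [k] too,
    hence [1 = a * k + b * s]. *)
Lemma sigma_maximal_unit (R : comUnitRingType) (k s : R) :
  (forall M, maximal_ideal M -> M k) ->
  sigma k s <-> s \is a GRing.unit.
Proof.
move=> Mk; rewrite sigmaP; split=> [[a [b ab]]|sU]; last first.
  by exists 0, s^-1; rewrite mul0r add0r mulVr.
apply/ideal_gen1_unit; apply: contrapT => s1.
have [M Mmax sM] := exists_maximal_ideal _ _ (is_ideal_gen _ _) s1.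
apply: (maximal_ideal_not1 _ _ Mmax); rewrite -ab; have [[_ MD MM] _ _] := Mmax.
by apply: MD; apply: MM; [exact: Mk|apply: sM; exact: mem_ideal_gen].
Qed.

Lemma open_sigma0 (R : idomainType) (k : R) : k != 0 -> open (sigma0 k).
Proof.
move=> k0; apply/macias_openE; exists [set sigma0 k]; last exact: bigcup_set1.
by move=> _ ->; exists k.
Qed.

Theorem corollary3p21 (R : idomainType)
    (R_infinite : infinite_set [set: R])
    (R_pid : is_pid R)
    (R_not_field : ~ GRing.field_axiom R)
    (units_not_open : ~ open (@macias_units R)) :
  infinite_set [set I : set R | maximal_ideal I].
Proof.
move=> /finite_ideals_common_neq0[|k k0 Mk].
  by move=> M Mmax; split; [case: Mmax|exact: maximal_ideal_neq0].
apply: units_not_open; have -> : @macias_units R = sigma0 k.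
  by apply/seteqP; split=> u; rewrite /sigma0 /= sigma_maximal_unit.
exact: open_sigma0.
Qed.
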